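(* Let $k$ be a field of characteristic zero or of odd prime characteristic, let $V$ be a $2n$-dimensional $k$-vector space with a fixed symplectic form $\omega_0\in\Lambda^2V^*$, let $\mathfrak g^+\subset\mathfrak{gl}(V)$ be the subspace of endomorphisms $x$ with $\omega_0(xu,v)=\omega_0(u,xv)$ for all $u,v\in V$, and let $\mathrm N_+:\mathfrak g^+\to\mathbb A^1$ be the Pfaffian norm, defined by $\mathrm N_+(x)\,\mu(\omega_0)=\mu(\omega_0x)$, where $\mu(\omega)=\omega^n\in\Lambda^{2n}V^*$. Let $\mathfrak C_{\mathfrak g^+}\subset\mathfrak g^+\times\mathfrak g^+$ be the commuting subscheme, consisting of pairs $(x,y)$ with $xy=yx$. Then the equality $$\mathrm N_+(xy)=\mathrm N_+(x)\,\mathrm N_+(y)$$ holds in the coordinate ring of $\mathfrak C_{\mathfrak g^+}$.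
   Context: A bilinear form on $V$ is viewed as an element of $\mathrm{Hom}_k(V,V^* )=V^*\otimes_kV^*$; $\Lambda^2V^*$ is the subspace of alternating forms. The map $\mu:\Lambda^2V^*\to\Lambda^{2n}V^*$ is the homogeneous polynomial law of degree $n$ (a morphism of functors on $k$-algebras $R$, compatible with scalar extension) sending an alternating form $\omega$ to the image of $\omega^n\in\mathrm S^n(\Lambda^2V^* )$ in the line $\Lambda^{2n}V^*$ under multiplication in the exterior algebra $\Lambda^\bullet V^*$. A symplectic form is a non-degenerate alternating bilinear form. The map $x\mapsto\omega_0x$ (the composite of $x:V\to V$ with $\omega_0:V\to V^*$) is an isomorphism of $k$-vector spaces $\mathfrak g^+\to\Lambda^2V^*$. For every $k$-algebra $R$ and $x\in\mathfrak g^+(R)=\mathfrak g^+\otimes_kR$, the element $\mathrm N_+(x)\in R$ is determined by $\mathrm N_+(x)\mu(\omega_0)=\mu(\omega_0x)$ in $\Lambda^{2n}V^*\otimes_kR$, $\mu(\omega_0)$ being taken to be a generator of this free rank-one $R$-module. For $x,y\in\mathfrak g^+$ one has $xy\in\mathfrak g^+$ if and only if $xy=yx$, so $\mathrm N_+(xy)$ makes sense on $\mathfrak C_{\mathfrak g^+}$. The scheme $\mathfrak C_{\mathfrak g^+}$ is not assumed reduced; the equality in its coordinate ring is equivalent to $\mathrm N_+(xy)=\mathrm N_+(x)\mathrm N_+(y)$ in $R$ for every $k$-algebra $R$ and every $(x,y)\in\mathfrak C_{\mathfrak g^+}(R)$.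
   Formalization: In characteristic 0<p≤n the power ω₀ⁿ = n!·Pf vanishes, so N₊ is undefined; the result is proved with μ(ω) the divided power (Pfaffian) in every characteristic ≠ 2, and with μ(ω)=ωⁿ whenever ω₀ⁿ is a generator. *)

(* Defs.v *)
From HB Require Import structures.
From mathcomp Require Import all_boot all_order all_algebra.
From mathcomp Require Import sesquilinear.
From mathcomp Require Import boolp classical_sets.

Set Implicit Arguments.
Unset Strict Implicit.
Unset Printing Implicit Defensive.

Import GRing.Theory VectorInternalTheory.
Local Open Scope ring_scope.

Section ExteriorAlgebra.

Variables (R : comNzRingType) (M : lmodType R).

(* An element of the exterior algebra of the dual of M (M free of finite rank)
   is encoded by its values on finite lists of vectors: its component of
   degree p is the function it induces on lists of length p. *)
Definition ext_form := seq M -> R.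

Definition multilinear (p : nat) (F : ext_form) : Prop :=
  forall (s1 s2 : seq M) (a : R) (u v : M), (size s1 + size s2 + 1 = p)%N ->
    F (s1 ++ (a *: u + v) :: s2) = a * F (s1 ++ u :: s2) + F (s1 ++ v :: s2).

Definition alternating (p : nat) (F : ext_form) : Prop :=
  forall (s1 s2 s3 : seq M) (u : M), (size s1 + size s2 + size s3 + 2 = p)%N ->
    F (s1 ++ u :: s2 ++ u :: s3) = 0.

Definition ext_power (p : nat) (F : ext_form) : Prop :=
  [/\ forall s, size s != p -> F s = 0, multilinear p F & alternating p F].

Definition generates (p : nat) (F : ext_form) : Prop :=
  ext_power p F /\
  forall G, ext_power p G -> exists! c : R, forall s, G s = c * F s.

(* number of inversions of the shuffle that moves the positions selected by m
   before the other ones *)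
Fixpoint shuffle_inv (m : bitseq) : nat :=
  if m is b :: m' then (~~ b * count id m' + shuffle_inv m')%N else 0%N.

(* (F /\ G)(v_1, ..., v_q) is the sum, over the subsets A of {1, ..., q}, of
   the signed products of F at (v_i), i in A, and of G at (v_i), i not in A. *)
Definition wedge (F G : ext_form) : ext_form := fun s =>
  \sum_(m : (size s).-tuple bool)
    (-1) ^+ shuffle_inv m * F (mask m s) * G (mask (map negb m) s).

Definition ext_unit : ext_form := fun s => (nilp s)%:R.

Definition form1 (l : M -> R) : ext_form := fun s =>
  if s is [:: u] then l u else 0.

Definition form2 (w : M -> M -> R) : ext_form := fun s =>
  if s is [:: u; v] then w u v else 0.

Definition wedge_pow (n : nat) (w : M -> M -> R) : ext_form :=
  iter n (wedge (form2 w)) ext_unit.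

(* The n-th divided power w^[n] of w.  It is characterized by the fact that
   its contraction with v is w(v, .) /\ w^[n - 1]; its value at
   (v_1, ..., v_2n) is the Pfaffian of the matrix w(v_i, v_j).
   One has w ^ n = n! w^[n] (wedge_pow_dpow below), so that w^[n] is w ^ n up
   to a unit when n! is invertible; but if 0 < p <= n in characteristic p then
   w ^ n = 0, and only w^[n] can generate the top exterior power. *)
Fixpoint wedge_dpow (n : nat) (w : M -> M -> R) : ext_form :=
  if n is n'.+1 then
    fun s => if s is v :: s' then wedge (form1 (w v)) (wedge_dpow n' w) s'
             else 0
  else ext_unit.

Lemma wedge_nil F G : wedge F G [::] = F [::] * G [::].
Proof.
rewrite /wedge (big_pred1 [tuple]) => [|m]; first by rewrite mul1r.
by rewrite [m]tuple0; apply/esym/eqP; apply: val_inj.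
Qed.

Lemma wedge_cons F G v s :
  wedge F G (v :: s) =
    wedge (fun t => F (v :: t)) G s +
    wedge (fun t => (-1) ^+ size t * F t) (fun t => G (v :: t)) s.
Proof.
rewrite /wedge.
pose h (p : bool * (size s).-tuple bool) : (size s).+1.-tuple bool :=
  [tuple of p.1 :: p.2].
rewrite (reindex h) /=; last first.
  exists (fun t => (thead t, [tuple of behead t])) => [[b m] _|m _] /=.
    by congr (_, _); apply: val_inj.
  by rewrite /h /= -tuple_eta.
rewrite -(pair_big xpredT xpredT (fun (b : bool) (m : (size s).-tuple bool) =>
  (-1) ^+ shuffle_inv (h (b, m)) * F (mask (h (b, m)) (v :: s)) *
  G (mask (map negb (h (b, m))) (v :: s)))) /= big_bool /=; congr (_ + _).
apply: eq_bigr => m _; rewrite mul1n size_mask ?size_tuple // exprD.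
by congr (_ * _); rewrite -mulrA mulrCA.
Qed.

Lemma eq_wedge F F' G G' : F =1 F' -> G =1 G' -> wedge F G =1 wedge F' G'.
Proof.
by move=> eF eG s; apply: eq_bigr => m _; rewrite eF eG.
Qed.

Lemma wedgeDr F G G' s :
  wedge F (fun t => G t + G' t) s = wedge F G s + wedge F G' s.
Proof.
by rewrite /wedge -big_split; apply: eq_bigr => m _; rewrite mulrDr.
Qed.

Lemma wedgeZr F c G s : wedge F (fun t => c * G t) s = c * wedge F G s.
Proof.
by rewrite /wedge big_distrr; apply: eq_bigr => m _; rewrite mulrCA.
Qed.

Lemma wedgeZl F c G s : wedge (fun t => c * F t) G s = c * wedge F G s.
Proof.
rewrite /wedge big_distrr; apply: eq_bigr => m _ /=.
by rewrite [_ * (c * _)]mulrCA !mulrA.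
Qed.

Lemma wedge0l G s : wedge (fun=> 0) G s = 0.
Proof. by rewrite /wedge big1 // => m _; rewrite mulr0 mul0r. Qed.

Lemma wedge_deg0 c G s : wedge (fun t => if nilp t then c else 0) G s = c * G s.
Proof.
elim: s G => [|v s IH] G; first by rewrite wedge_nil.
rewrite wedge_cons /= wedge0l add0r.
rewrite (eq_wedge (F' := fun t => if nilp t then c else 0)
                  (G' := fun t => G (v :: t))) ?IH //.
by case=> [|a t] /=; rewrite ?mul1r ?mulr0.
Qed.

Lemma wedge_form1_cons l G v s :
  wedge (form1 l) G (v :: s) =
    l v * G s - wedge (form1 l) (fun t => G (v :: t)) s.
Proof.
rewrite wedge_cons; congr (_ + _).
  by rewrite -wedge_deg0; apply: eq_wedge => // -[|? ?].
rewrite -[RHS]mulN1r -wedgeZl; apply: eq_wedge => //.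
by case=> [|a [|b t]] /=; rewrite ?mulr0.
Qed.

Lemma wedge_form2_cons w G v s :
  wedge (form2 w) G (v :: s) =
    wedge (form1 (w v)) G s + wedge (form2 w) (fun t => G (v :: t)) s.
Proof.
rewrite wedge_cons; congr (_ + _); apply: eq_wedge => //.
by case=> [|a [|b [|c t]]] /=; rewrite ?mulr0 // expr2 mulN1r opprK mul1r.
Qed.

Lemma wedge_form11C l l' G s :
  wedge (form1 l) (wedge (form1 l') G) s =
    - wedge (form1 l') (wedge (form1 l) G) s.
Proof.
elim: s G => [|v s IH] G; first by rewrite !wedge_nil /= !mul0r oppr0.
have E l1 l2 :
    wedge (form1 l1) (wedge (form1 l2) G) (v :: s) =
    l1 v * wedge (form1 l2) G s - (l2 v * wedge (form1 l1) G s
      - wedge (form1 l1) (wedge (form1 l2) (fun t => G (v :: t))) s).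
  rewrite wedge_form1_cons; congr (_ - _).
  rewrite (eq_wedge (F' := form1 l1) (G' := fun t => l2 v * G t +
    (-1) * wedge (form1 l2) (fun t => G (v :: t)) t)) //.
    by rewrite wedgeDr !wedgeZr mulN1r.
  by move=> t; rewrite wedge_form1_cons mulN1r.
rewrite !E IH; set a := _ * _; set b := _ * _; set c := wedge _ _ _.
by rewrite !opprB addrA.
Qed.

Lemma wedge_form21C w l G s :
  wedge (form2 w) (wedge (form1 l) G) s =
    wedge (form1 l) (wedge (form2 w) G) s.
Proof.
elim: s G => [|v s IH] G; first by rewrite !wedge_nil /= !mul0r.
rewrite wedge_form2_cons wedge_form1_cons.
rewrite (eq_wedge (F := form2 w) (F' := form2 w) (G' := fun t => l v * G t +
  (-1) * wedge (form1 l) (fun t => G (v :: t)) t)) //; last first.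
  by move=> t; rewrite wedge_form1_cons mulN1r.
rewrite (eq_wedge (F := form1 l) (F' := form1 l) (G' := fun t =>
  wedge (form1 (w v)) G t + wedge (form2 w) (fun t => G (v :: t)) t)) //;
  last by move=> t; rewrite wedge_form2_cons.
rewrite !wedgeDr !wedgeZr mulN1r IH [X in X + _]wedge_form11C opprD.
by rewrite addrCA.
Qed.

Lemma wedge_powS_cons n w v s :
  wedge_pow n.+1 w (v :: s) =
    n.+1%:R * wedge (form1 (w v)) (wedge_pow n w) s.
Proof.
elim: n s => [|n IH] s.
  rewrite /wedge_pow /= wedge_form2_cons mul1r -[RHS]addr0; congr (_ + _).
  by rewrite (eq_wedge (F' := form2 w) (G' := fun t => 0 * 0)) ?wedgeZr ?mul0r
             // => t; rewrite mul0r.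
rewrite [LHS]wedge_form2_cons.
rewrite (eq_wedge (F := form2 w) (F' := form2 w) (G' := fun t =>
  n.+1%:R * wedge (form1 (w v)) (wedge_pow n w) t)) //.
by rewrite wedgeZr wedge_form21C -[X in X + _]mul1r -mulrDl -mulrS.
Qed.

Lemma wedge_pow_dpow n w s : wedge_pow n w s = n`!%:R * wedge_dpow n w s.
Proof.
elim: n s => [|n IH] [|v s]; rewrite ?mul1r //.
  by rewrite mulr0 /wedge_pow /= wedge_nil mul0r.
rewrite wedge_powS_cons factS natrM -mulrA; congr (_ * _).
by rewrite [wedge_dpow _ _ _]/= -wedgeZr; apply: eq_wedge.
Qed.

End ExteriorAlgebra.

Section PfaffianNorm.

Variables (k : fieldType) (V : vectType k).

Definition symplectic (w : V -> V -> k) : Prop :=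
  (forall u, w u u = 0) /\ (forall u, (forall v, w u v = 0) -> u = 0).

Definition gplus (w : V -> V -> k) (x : 'End(V)) : Prop :=
  forall u v, w (x u) v = w u (x v).

Variable R : comAlgType k.

(* V (x) R, in the coordinates v2r that are part of the vectType structure *)
Definition base_space : vectType R := 'rV[R]_(dim V).

Definition base_vect (v : V) : base_space := map_mx (in_alg R) (v2r v).

Definition base_form (w : V -> V -> k) : base_space -> base_space -> R :=
  fun u v => \sum_(i < dim V) \sum_(j < dim V)
    u 0 i * v 0 j * (w (r2v (delta_mx 0 i)) (r2v (delta_mx 0 j)))%:A.

Definition base_end (x : 'End(V)) : 'End(base_space) :=
  linfun (mulmxr (map_mx (in_alg R) (f2mx x))).

(* g^+ (x) R, as the R-span of g^+ in End(V) (x) R = End_R(V (x) R) *)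
Definition gplus_pts (w : V -> V -> k) (x : 'End(base_space)) : Prop :=
  exists (m : nat) (r : 'I_m -> R) (y : 'I_m -> 'End(V)),
    (forall i, gplus w (y i)) /\ x = \sum_i r i *: base_end (y i).

Definition commuting_pts (w : V -> V -> k) (x y : 'End(base_space)) : Prop :=
  [/\ gplus_pts w x, gplus_pts w y & (x \o y = y \o x)%VF].

(* The element c of R with c mu(w) = mu(w x). *)
Definition pfaffian_norm
    (mu : (base_space -> base_space -> R) -> ext_form base_space) (w : V -> V -> k)
    (x : 'End(base_space)) : R :=
  xget 0 [set c | forall s, c * mu (base_form w) s =
                            mu (fun u v => base_form w (x u) v) s].

Lemma base_formE (w : {biscalar V}) u v :
  base_form w (base_vect u) (base_vect v) = (w u v)%:A.
Proof.
have E (x : V) : x = \sum_i v2r x 0 i *: r2v (delta_mx 0 i).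
  rewrite -[LHS]v2rK [in LHS](row_sum_delta (v2r x)) linear_sum.
  by apply: eq_bigr => i _; rewrite linearZ.
rewrite [in RHS](E u) linear_sumlz scaler_suml; apply: eq_bigr => i _.
rewrite linearZl_LR [in RHS](E v) linear_sumr mulr_sumr scaler_suml.
apply: eq_bigr => j _; rewrite linearZr_LR !mxE /=.
by rewrite -[LHS]/(in_alg R _ * in_alg R _ * in_alg R _) -!rmorphM mulrA.
Qed.

Lemma base_endE (x : 'End(V)) v : base_end x (base_vect v) = base_vect (x v).
Proof.
rewrite lfunE /= /base_vect -map_mxM; congr map_mx.
by rewrite [in RHS]unlock /= r2vK.
Qed.

End PfaffianNorm.

(* Main.v *)
(* A congruence W |-> A W A^T multiplies the Pfaffians of all alternating W by
   the same factor, because alternating forms of top degree are proportional.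
   If y = u^2 with u self-adjoint and commuting with x, then omega_0 x y is the
   pull-back of omega_0 x by u and omega_0 y that of omega_0, whence
   N(x y) = N(x) N(y).  For general y, the element 1 + t (y - 1) over R[t] is
   congruent modulo every power of t to the square of a polynomial in y, since
   2 is invertible; so N(x (1 + t (y - 1))) = N(x) N(1 + t (y - 1)) in R[t],
   and t = 1 gives the result. *)
Require Import Defs.
From HB Require Import structures.
From mathcomp Require Import all_boot all_order all_algebra.
From mathcomp Require Import sesquilinear ring boolp classical_sets.

Set Implicit Arguments.
Unset Strict Implicit.
Unset Printing Implicit Defensive.

Import GRing.Theory VectorInternalTheory.
Local Open Scope ring_scope.

(** * Alternating forms as functions on lists, and wedge products with linear forms *)

Section AlternatingForms.

Variables (R : comNzRingType) (M : lmodType R).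
Implicit Types (F G : ext_form M) (s t : seq M).

Definition homogeneous p F := forall s, size s != p -> F s = 0.

(** Free of conditions on lengths, [multi] and [adj_alt] pass to contractions without degree
    bookkeeping; [ext_powerP] links them to [ext_power]. *)
Definition multi F := forall s1 s2 a u v,
  F (s1 ++ (a *: u + v) :: s2) = a * F (s1 ++ u :: s2) + F (s1 ++ v :: s2).

Definition adj_alt F := forall s1 s2 u, F (s1 ++ u :: u :: s2) = 0.

Lemma multi_contract F v : multi F -> multi (fun t => F (v :: t)).
Proof. by move=> mF s1 s2 a x y; exact: (mF (v :: s1)). Qed.

Lemma adj_alt_contract F v : adj_alt F -> adj_alt (fun t => F (v :: t)).
Proof. by move=> aF s1 s2 u; exact: (aF (v :: s1)). Qed.

Lemma multiD F s1 s2 u v : multi F ->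
  F (s1 ++ (u + v) :: s2) = F (s1 ++ u :: s2) + F (s1 ++ v :: s2).
Proof. by move=> mF; have := mF s1 s2 1 u v; rewrite scale1r mul1r. Qed.

Lemma multi0 F s1 s2 : multi F -> F (s1 ++ 0 :: s2) = 0.
Proof.
move=> mF; have := multiD s1 s2 0 0 mF; rewrite addr0 => /eqP.
by rewrite -subr_eq subrr => /eqP.
Qed.

Lemma multiZ F s1 s2 a u : multi F ->
  F (s1 ++ (a *: u) :: s2) = a * F (s1 ++ u :: s2).
Proof.
by move=> mF; have := mF s1 s2 a u 0; rewrite (multi0 _ _ mF) !addr0.
Qed.

Lemma multi_sum F s1 s2 (I : Type) (r : seq I) (u : I -> M) : multi F ->
  F (s1 ++ (\sum_(i <- r) u i) :: s2) = \sum_(i <- r) F (s1 ++ u i :: s2).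
Proof.
move=> mF; elim: r => [|i r IH]; first by rewrite !big_nil multi0.
by rewrite !big_cons multiD // IH.
Qed.

Lemma multi_swap F s1 s2 u v : multi F -> adj_alt F ->
  F (s1 ++ u :: v :: s2) = - F (s1 ++ v :: u :: s2).
Proof.
move=> mF aF; have := aF s1 s2 (u + v).
rewrite (multiD _ _ _ _ mF).
rewrite -(cat_rcons u s1 ((u + v) :: s2)) -(cat_rcons v s1 ((u + v) :: s2)).
rewrite !(multiD _ _ _ _ mF) !cat_rcons !aF add0r addr0.
by move/eqP; rewrite addr_eq0 => /eqP.
Qed.

Lemma multi_move F s1 s2 s3 u : multi F -> adj_alt F ->
  F (s1 ++ s2 ++ u :: s3) = (-1) ^+ size s2 * F (s1 ++ u :: s2 ++ s3).
Proof.
move=> mF aF; elim: s2 s1 => [|v s2 IH] s1 /=; first by rewrite mul1r.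
by rewrite -cat_rcons IH cat_rcons multi_swap // exprS mulN1r mulrN mulNr.
Qed.

(** Transporting only the vanishing avoids signs of permutations: each entry of [l'] in turn is
    moved to the front of [l] and absorbed into the prefix [s1]. *)
Lemma multi_perm F (I : eqType) (e : I -> M) s1 (l l' : seq I) :
  multi F -> adj_alt F -> perm_eq l l' ->
  F (s1 ++ map e l) = 0 -> F (s1 ++ map e l') = 0.
Proof.
move=> mF aF; elim: l' s1 l => [|b l' IH] s1 l.
  by move/perm_nilP ->.
move=> pl; have := perm_mem pl b; rewrite mem_head => bl.
case/splitPr: bl pl => p q; rewrite -(cat1s b q) perm_catCA perm_cons => pl.
rewrite map_cat /= multi_move // -cat_rcons -map_cat -cat_rcons => H.
apply: (IH _ _ pl).
by rewrite -[LHS](signrMK (size (map e p))) H mulr0.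
Qed.

(** Outside degree [p], homogeneity makes both identities trivial; two equal vectors that are apart
    are made adjacent by [multi_move]. *)
Lemma ext_powerP p F :
  ext_power p F <-> [/\ homogeneous p F, multi F & adj_alt F].
Proof.
split=> [[hF mF aF]|[hF mF aF]].
  split=> // [s1 s2 a u v|s1 s2 u].
    have [e|ne] := eqVneq (size s1 + size s2 + 1)%N p; first exact: mF.
    by rewrite !hF ?size_cat /= ?mulr0 ?addr0 // addnS -addn1.
  have [e|ne] := eqVneq (size s1 + 0 + size s2 + 2)%N p; last first.
    by rewrite hF // size_cat /= -addn2 addnA -(addn0 (size s1)).
  exact: (aF s1 [::]).
split=> // s1 s2 s3 u _.
by rewrite -cat_rcons multi_move // cat_rcons aF mulr0.
Qed.

Lemma alt_nuniq F (I : eqType) (e : I -> M) s1 (l : seq I) :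
  multi F -> adj_alt F -> ~~ uniq l -> F (s1 ++ map e l) = 0.
Proof.
move=> mF aF; elim: l s1 => //= i l IH s1; rewrite negb_and negbK.
case/orP => [il|nl]; last by rewrite -cat_rcons IH.
case/splitPr: il => p q; rewrite map_cat /= -cat_rcons multi_move //.
by rewrite cat_rcons aF mulr0.
Qed.

Lemma wedge_eq0r F G s : (forall t, G t = 0) -> wedge F G s = 0.
Proof. by move=> G0; rewrite /wedge big1 // => m _; rewrite G0 mulr0. Qed.

Lemma ext_power_eq p F G : F =1 G -> ext_power p G -> ext_power p F.
Proof.
move=> e [hG mG aG]; split=> [s|s1 s2 a u v|s1 s2 s3 u]; rewrite !e;
  by [exact: hG|exact: mG|exact: aG].
Qed.

Lemma homogeneous_wedge1 l G p :
  homogeneous p G -> homogeneous p.+1 (wedge (form1 l) G).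
Proof.
move=> hG s ne; rewrite /wedge big1 // => m _.
have := count_predC id m; rewrite size_tuple.
have sm : size m = size s by rewrite size_tuple.
have snm : size (map negb m) = size s by rewrite size_map.
have e1 := size_mask sm; have e2 := size_mask snm.
move: e1 e2; rewrite count_map.
(* [form1 l] vanishes unless its share of [s] is a single vector, which leaves [size s - 1] vectors
   to [G]. *)
case: (mask m s) => [|a [|b t]] /=; rewrite ?mulr0 ?mul0r // => <- e E.
rewrite hG ?mulr0 // e; apply: contra ne => /eqP <-.
by apply/eqP; rewrite -[LHS]E add1n.
Qed.

Lemma multi_wedge1 (l : M -> R) G : scalar l -> multi G ->
  multi (wedge (form1 l) G).
Proof.
move=> ll mG s1 s2 a u v; elim: s1 G mG => [|b s1 IH] G mG /=.
  rewrite !wedge_form1_cons ll.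
  rewrite (eq_wedge (F' := form1 l)
    (G' := fun t => a * G (u :: t) + G (v :: t))) //; last first.
    by move=> t; exact: (mG [::]).
  by rewrite wedgeDr wedgeZr mulrDl mulrBr mulrA opprD addrACA.
rewrite !wedge_form1_cons mG (IH (fun t => G (b :: t))); last first.
  exact: multi_contract.
by rewrite mulrDr mulrBr opprD addrACA mulrCA.
Qed.

Lemma adj_alt_wedge1 l G : adj_alt G -> adj_alt (wedge (form1 l) G).
Proof.
move=> aG s1 s2 u; elim: s1 G aG => [|b s1 IH] G aG /=; last first.
  rewrite wedge_form1_cons aG (IH (fun t => G (b :: t))) ?mulr0 ?subr0 //.
  exact: adj_alt_contract.
(* The two terms with [l u] cancel; what is left involves [G] contracted twice with [u]. *)
rewrite 2!wedge_form1_cons opprB addrCA subrr addr0.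
by apply: wedge_eq0r => t; exact: (aG [::]).
Qed.

(** Proved by contraction, since [wedge_form11C] would only give that twice the value is 0. *)
Lemma wedge11 l G s : wedge (form1 l) (wedge (form1 l) G) s = 0.
Proof.
elim: s G => [|v s IH] G; first by rewrite wedge_nil mul0r.
rewrite wedge_form1_cons.
rewrite [X in _ - X](eq_wedge (F' := form1 l) (G' := fun t => l v * G t +
    (-1) * wedge (form1 l) (fun t => G (v :: t)) t)) //.
  by rewrite wedgeDr !wedgeZr IH mulr0 addr0 subrr.
by move=> t; rewrite wedge_form1_cons mulN1r.
Qed.

Lemma wedge1_eq0 l G s : (forall u, u \in s -> l u = 0) ->
  wedge (form1 l) G s = 0.
Proof.
elim: s G => [|v s IH] G ls; first by rewrite wedge_nil mul0r.
rewrite wedge_form1_cons ls ?mem_head // mul0r IH ?subrr // => u us.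
by rewrite ls // inE us orbT.
Qed.

Lemma wedge1D a l l' G s :
  wedge (form1 (fun v => a * l v + l' v)) G s =
    a * wedge (form1 l) G s + wedge (form1 l') G s.
Proof.
elim: s G => [|v s IH] G; first by rewrite !wedge_nil /= !mul0r mulr0 addr0.
by rewrite !wedge_form1_cons IH mulrDl mulrBr opprD addrACA mulrA.
Qed.

Lemma eq_form1 (l l' : M -> R) : l =1 l' -> form1 l =1 form1 l'.
Proof. by move=> e [|a [|b s]] /=. Qed.

Lemma eq_wedge_dpow n (w w' : M -> M -> R) : w =2 w' ->
  wedge_dpow n w =1 wedge_dpow n w'.
Proof.
move=> e; elim: n => [|n IH] [|v s] //=.
exact: eq_wedge (eq_form1 (e v)) IH s.
Qed.

Lemma ext_power_dpow n (w : M -> M -> R) :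
  (forall v, scalar (w v)) -> (forall v, scalar (w^~ v)) ->
  (forall v, w v v = 0) -> ext_power (2 * n) (wedge_dpow n w).
Proof.
move=> wr wl w0; apply/ext_powerP; elim: n => [|n [hD mD aD]].
  split=> [[|a s] //|s1 s2 a u v|s1 s2 u] /=; rewrite /ext_unit;
  by case: s1 => [|? ?] /=; rewrite ?mulr0 ?addr0.
split=> [[|v s] //= ne|s1 s2 a u v|s1 s2 u].
- apply: (homogeneous_wedge1 _ hD); apply: contra ne => /eqP ->.
  by rewrite mulnS.
- case: s1 => [|b s1] /=; last exact: multi_wedge1.
  rewrite -wedge1D; apply: eq_wedge => //; apply: eq_form1 => x.
  exact: wl.
- case: s1 => [|b s1] /=; last exact: adj_alt_wedge1.
  (* Contracting twice with [u] produces the linear form [w u] twice, so [wedge11] applies; for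
     [n = 0] the unit has zero contraction. *)
  rewrite wedge_form1_cons w0 mul0r sub0r; case: n {hD mD aD} => [|n] /=.
    by rewrite wedge_eq0r ?oppr0.
  by rewrite wedge11 oppr0.
Qed.

End AlternatingForms.

(** * Naturality of wedge products and divided powers *)

Lemma wedge_morph (R S : comNzRingType) (M : lmodType R) (N : lmodType S)
    (f : {rmorphism R -> S}) (g : M -> N) F G F' G' s :
  (forall t, f (F t) = F' (map g t)) -> (forall t, f (G t) = G' (map g t)) ->
  f (wedge F G s) = wedge F' G' (map g s).
Proof.
move=> eF eG; rewrite /wedge size_map rmorph_sum; apply: eq_bigr => m _.
by rewrite !rmorphM rmorph_sign eF eG !map_mask.
Qed.

(** Serves for congruences and coordinates ([f] the identity) as well as for specialization of
    scalars ([g] induced by [f]). *)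
Lemma wedge_dpow_morph (R S : comNzRingType) (M : lmodType R) (N : lmodType S)
    (f : {rmorphism R -> S}) (g : M -> N) n w w' s :
  (forall u v, f (w u v) = w' (g u) (g v)) ->
  f (wedge_dpow n w s) = wedge_dpow n w' (map g s).
Proof.
move=> e; elim: n s => [|n IH] [|v s] /=; rewrite ?rmorph1 ?rmorph0 //.
by apply: wedge_morph => // -[|a [|b t]] /=; rewrite ?rmorph0.
Qed.

(** * Forms of top degree and Pfaffians of matrices *)

Section TopForms.

Variables (R : comNzRingType) (d : nat).
Notation M := 'rV[R]_d.
Implicit Types (F G : ext_form M).

Definition std_basis : seq M := map (delta_mx 0) (enum 'I_d).

Lemma top_form_eq0 F : ext_power d F -> F std_basis = 0 -> forall s, F s = 0.
Proof.
move=> /ext_powerP[hF mF aF] F0 s.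
(* The vectors of [t] are expanded one by one in the basis, their indices joining [l]; in the end
   [l] has a repetition or is a permutation of all indices. *)
suff H (l : seq 'I_d) t : F (map (delta_mx 0) l ++ t) = 0 by exact: (H [::]).
elim: t l => [|v t IH] l.
  rewrite cats0; have [sl|] := eqVneq (size l) d; last first.
    by move=> ne; apply: hF; rewrite size_map.
  have [ul|nul] := boolP (uniq l); last exact: (alt_nuniq _ [::]).
  apply: (multi_perm (s1 := [::]) mF aF _ F0).
  apply: uniq_perm; rewrite ?enum_uniq // => i.
  have [||_ ->] // := uniq_min_size ul (_ : {subset l <= enum 'I_d}).
    by move=> j _; rewrite mem_enum.
  by rewrite size_enum_ord sl.
rewrite (row_sum_delta v) multi_sum // big1 // => i _.
by rewrite multiZ // -cat_rcons -map_rcons IH mulr0.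
Qed.

Lemma top_form_prop F G s : ext_power d F -> ext_power d G ->
  F s * G std_basis = G s * F std_basis.
Proof.
move=> /ext_powerP[hF mF aF] /ext_powerP[hG mG aG]; apply/eqP.
rewrite -subr_eq0; apply/eqP.
pose H : ext_form M := fun s => F s * G std_basis - G s * F std_basis.
apply: (@top_form_eq0 H); last by rewrite /H mulrC subrr.
apply/ext_powerP; split=> [t nt|s1 s2 a u v|s1 s2 u]; rewrite /H.
- by rewrite (hF t) ?(hG t) // !mul0r subrr.
- by rewrite mF mG !mulrDl mulrBr opprD addrACA !mulrA.
- by rewrite aF aG !mul0r subrr.
Qed.

Definition mxform (W : 'M[R]_d) (u v : M) : R := (u *m W *m v^T) 0 0.

(** The Pfaffian of [W] when [d = 2n] and [W] is alternating. *)
Definition pf n (W : 'M[R]_d) : R := wedge_dpow n (mxform W) std_basis.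

Lemma mxform_sum (W : 'M_d) u v :
  mxform W u v = \sum_i \sum_j u 0 i * v 0 j * W i j.
Proof.
rewrite /mxform !mxE exchange_big; apply: eq_bigr => j _.
rewrite !mxE mulr_suml; apply: eq_bigr => i _; exact: mulrAC.
Qed.

Lemma mxform_delta (W : 'M_d) i j :
  mxform W (delta_mx 0 i) (delta_mx 0 j) = W i j.
Proof. by rewrite /mxform trmx_delta -rowE -colE !mxE. Qed.

Lemma mxform_congr (A W : 'M_d) u v :
  mxform (A *m W *m A^T) u v = mxform W (u *m A) (v *m A).
Proof. by rewrite /mxform trmx_mul !mulmxA. Qed.

Lemma ext_power_mxform n (W : 'M_d) (half : R) : half *+ 2 = 1 -> W^T = - W ->
  ext_power (2 * n) (wedge_dpow n (mxform W)).
Proof.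
move=> h2 skewW; apply: ext_power_dpow => [v a u1 u2|v a u1 u2|v].
- by rewrite /mxform linearD linearZ mulmxDr -scalemxAr !mxE.
- by rewrite /mxform mulmxDl -scalemxAl mulmxDl -scalemxAl !mxE.
(* A 1 x 1 matrix equals its transpose; as 2 is invertible, skew-symmetric forms are alternating. *)
have : mxform W v v = - mxform W v v.
  rewrite [LHS]/mxform -[v *m W *m _]trmxK mxE 2!trmx_mul trmxK skewW.
  by rewrite mulNmx mulmxN mxE mulmxA.
move/eqP; rewrite -addr_eq0 -mulr2n => /eqP e.
by rewrite -[LHS]mul1r -h2 mulrnAl -mulrnAr e mulr0.
Qed.

(** The Pfaffian of [A *m W *m A^T] is the form of [W] evaluated at the rows of [A].
    Cross-multiplication avoids both division and determinants. *)
Lemma pf_congr n (A W W0 : 'M_d) (half : R) : d = (2 * n)%N -> half *+ 2 = 1 ->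
  W^T = - W -> W0^T = - W0 ->
  pf n (A *m W *m A^T) * pf n W0 = pf n (A *m W0 *m A^T) * pf n W.
Proof.
move=> dn h2 sW sW0.
have E (B : 'M_d) : pf n (A *m B *m A^T) =
    wedge_dpow n (mxform B) (map (mulmxr A) std_basis).
  apply: (wedge_dpow_morph (f := idfun)) => u v; exact: mxform_congr.
rewrite !E; apply: top_form_prop; rewrite [X in ext_power X]dn;
  exact: (ext_power_mxform _ h2).
Qed.

(* If U is self-adjoint and commutes with X, then X U^2 W = U (X W) U^T. *)
Lemma pf_mul_sqr n (X U W : 'M_d) (half : R) : d = (2 * n)%N -> half *+ 2 = 1 ->
  W^T = - W -> X *m W = W *m X^T -> U *m W = W *m U^T -> U *m X = X *m U ->
  pf n (X *m (U *m U) *m W) * pf n W = pf n (X *m W) * pf n (U *m U *m W).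
Proof.
move=> dn h2 sW aX aU cUX.
have sXW : (X *m W)^T = - (X *m W) by rewrite trmx_mul sW mulNmx aX.
have := pf_congr U dn h2 sXW sW.
by rewrite mulmxA cUX -!mulmxA -aU !mulmxA => ->; rewrite mulrC.
Qed.

End TopForms.

(** * Multiplicativity of the Pfaffian on commuting self-adjoint matrices *)

Lemma pf_morph (R S : comNzRingType) (f : {rmorphism R -> S}) d n (W : 'M_d) :
  pf n (map_mx f W) = f (pf n W).
Proof.
rewrite /pf (@wedge_dpow_morph _ _ _ _ f (map_mx f) _ _ (mxform (map_mx f W))).
  congr wedge_dpow; rewrite /std_basis -[RHS]map_comp; apply: eq_map => i /=.
  by rewrite map_delta_mx.
by move=> u v; rewrite /mxform map_trmx -!map_mxM [RHS]mxE.
Qed.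

(** The Pfaffian of [W + x E] is a polynomial in [x], congruent to its constant term modulo [x]. In
    [pf_mul], [c] is a power of the variable. *)
Lemma pf_addZ (R : comNzRingType) d n (W E : 'M[R]_d) c :
  exists c', pf n (W + c *: E) = pf n W + c * c'.
Proof.
pose P := pf n (map_mx polyC W + 'X *: map_mx polyC E).
have hP x : pf n (W + x *: E) = P.[x].
  rewrite -[RHS]/(horner_eval x P) /P -pf_morph; congr (pf n _).
  apply/matrixP=> i j; rewrite !mxE /= /horner_eval.
  by rewrite hornerD hornerM hornerX !hornerC.
have /factor_theorem[q Pq] : root (P - (P.[0])%:P) 0.
  by rewrite /root hornerD hornerN hornerC subrr.
exists q.[c]; have := hP 0; rewrite scale0r addr0 hP => ->.
rewrite -[P in LHS](subrK (P.[0])%:P) Pq subr0 hornerD hornerMX hornerC.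
by rewrite addrC mulrC.
Qed.

(* Truncations of the binomial series of (1 + X)^(1/2). *)
Lemma sqrt_1X (R : comNzRingType) (half : R) m : half *+ 2 = 1 ->
  exists p q r : {poly R}, p = 1 + 'X * r /\ p ^+ 2 = 1 + 'X + 'X^(m.+1) * q.
Proof.
move=> h2; pose c : {poly R} := half%:P.
have c2 : c * 2%:R = 1 by rewrite mulr_natr -polyCMn h2.
elim: m => [|m [p [q [r [pr pq]]]]].
  exists 1, (-1), 0; split; first by rewrite mulr0 addr0.
  by rewrite expr1 mulrN1 addrK expr1n.
(* A Newton step: the correction turns the error ['X^(m.+1) * q] into ['X^(m.+1) * q * (1 - p)] plus
   higher terms, and [1 - p = - 'X * r] gains one order. *)
exists (p - c * 'X^(m.+1) * q), (- (q * r) + 'X^m * c ^+ 2 * q ^+ 2),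
  (r - c * 'X^m * q); split; first by rewrite pr exprS; ring.
have -> : (p - c * 'X^(m.+1) * q) ^+ 2 =
    p ^+ 2 - (c * 2%:R) * 'X^(m.+1) * q * p + c ^+ 2 * 'X^(m.+1) ^+ 2 * q ^+ 2.
  by ring.
by rewrite c2 pq pr !exprS; ring.
Qed.

Lemma horner_mx_adj (R : comNzRingType) d (A W : 'M[R]_d.+1) p :
  A *m W = W *m A^T -> horner_mx A p *m W = W *m (horner_mx A p)^T.
Proof.
move=> aA; elim/poly_ind: p => [|p c IH].
  by rewrite rmorph0 trmx0 mul0mx mulmx0.
rewrite rmorphD rmorphM /= horner_mx_X horner_mx_C linearD /= mulmxDl mulmxDr.
rewrite tr_scalar_mx scalar_mxC; congr (_ + _).
have cA : horner_mx A p *m A = A *m horner_mx A p by exact: comm_horner_mx.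
rewrite -mulmxE {2}cA trmx_mul -mulmxA aA.
by rewrite !mulmxA IH.
Qed.

Lemma polyXn_dvd_eq0 (R : nzRingType) (Q : {poly R}) :
  (forall m, exists q, Q = 'X^m * q) -> Q = 0.
Proof.
move=> H; apply/polyP=> i; have [q ->] := H i.+1.
by rewrite coefXnM coef0 ltnSn.
Qed.

Lemma pf_mul (R : comNzRingType) d n (X Y W : 'M[R]_d) (half : R) :
  d = (2 * n)%N -> half *+ 2 = 1 -> W^T = - W ->
  X *m W = W *m X^T -> Y *m W = W *m Y^T -> X *m Y = Y *m X ->
  pf n (X *m Y *m W) * pf n W = pf n (X *m W) * pf n (Y *m W).
Proof.
case: d X Y W => [|d] X Y W dn h2 sW aX aY cXY.
  (* In size 0 all matrices coincide; [horner_mx] below is for positive size. *)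
  by rewrite [X]flatmx0 [Y]flatmx0 [W]flatmx0 !mul0mx.
pose C := map_mx (@polyC R) : 'M_d.+1 -> 'M_d.+1.
pose Z := 'X *: (C Y - 1%:M).
(* Evaluating at 1 the polynomial Q, attached to 1 + t (Y - 1) in place of Y,
   gives the claim; Q vanishes modulo every power of t. *)
pose Q := pf n (C X *m (1%:M + Z) *m C W) * pf n (C W) -
          pf n (C X *m C W) * pf n ((1%:M + Z) *m C W).
have ev1 (P : 'M[R]_d.+1) : map_mx (horner_eval 1) (C P) = P.
  by apply/matrixP=> i j; rewrite !mxE [LHS]hornerC.
have evZ : map_mx (horner_eval 1) (1%:M + Z) = Y.
  apply/matrixP=> i j; rewrite !mxE /= /horner_eval.
  by rewrite hornerD hornerM hornerD hornerN hornerMn !hornerC hornerX; ring.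
suff Q0 : Q = 0.
  have : horner_eval 1 Q = 0 by rewrite Q0 rmorph0.
  rewrite rmorphB !rmorphM -!pf_morph !map_mxM !ev1 evZ.
  by move/eqP; rewrite subr_eq0 => /eqP.
have h2C : half%:P *+ 2 = 1 :> {poly R} by rewrite -polyCMn h2.
have sCW : (C W)^T = - C W by rewrite /C map_trmx sW map_mxN.
have aCX : C X *m C W = C W *m (C X)^T by rewrite /C map_trmx -!map_mxM aX.
have aZ : Z *m C W = C W *m Z^T.
  rewrite /Z -scalemxAl linearZ /= -scalemxAr linearB /= tr_scalar_mx.
  rewrite mulmxBl mulmxBr mul1mx mulmx1 /C map_trmx -!map_mxM.
  by rewrite aY.
have cZX : Z *m C X = C X *m Z.
  rewrite /Z -scalemxAl -scalemxAr mulmxBl mulmxBr mul1mx mulmx1.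
  by rewrite /C -!map_mxM cXY.
apply: polyXn_dvd_eq0 => m.
have [p [q [r [_ pq]]]] := sqrt_1X m h2C.
(* [U] is the approximate square root of [1 + Z]. As [Z] is ['X] times [C Y - 1], the error
   [Z ^+ m.+1 * horner_mx Z q] is ['X^(m.+1)] times [- E]. *)
pose U := horner_mx Z p; pose E := - ((C Y - 1%:M) ^+ m.+1 * horner_mx Z q).
have UE : 1%:M + Z = U *m U + 'X^(m.+1) *: E.
  have := congr1 (horner_mx Z) pq.
  rewrite expr2 !rmorphD rmorphM rmorphM rmorphXn rmorph1 /= horner_mx_X.
  by rewrite exprZn -scalerAl scalerN => /eqP; rewrite -subr_eq => /eqP <-.
have aU := horner_mx_adj p aZ.
have cUX : U *m C X = C X *m U by exact: comm_horner_mx.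
have e := pf_mul_sqr dn h2C sCW aCX aU cUX.
have [c1 e1] := pf_addZ n (C X *m (U *m U) *m C W) (C X *m E *m C W) 'X^(m.+1).
have [c2 e2] := pf_addZ n (U *m U *m C W) (E *m C W) 'X^(m.+1).
(* The main terms cancel by [e]; the remainders carry ['X^(m.+1)], one power more than required. *)
exists ('X * (c1 * pf n (C W) - pf n (C X *m C W) * c2)).
rewrite /Q UE mulmxDr !mulmxDl -scalemxAr -!scalemxAl e1 e2 mulrDl e mulrDr.
by rewrite exprSr; ring.
Qed.

(** * Symplectic forms and the Pfaffian of the Gram matrix *)

Section SymplecticSpace.

Variables (k : fieldType) (V : vectType k).

Lemma exists_orthogonal (w : {biscalar V}) (s : seq V) : (size s < dim V)%N ->
  exists2 v, v != 0 & forall u, u \in s -> w v u = 0.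
Proof.
move=> ss.
pose A := \matrix_(i < dim V, j < size s) w (r2v (delta_mx 0 i)) s`_j.
(* There are fewer linear conditions, the columns of [A], than coordinates. *)
have kn0 : kermx A != 0.
  rewrite kermx_eq0 /row_free neq_ltn.
  by rewrite (leq_ltn_trans (rank_leq_col A) ss).
exists (r2v (nz_row (kermx A))).
  apply: contra kn0 => /eqP /(congr1 v2r); rewrite r2vK linear0 => /eqP.
  by rewrite nz_row_eq0.
move=> u /(nthP 0)[j js <-]; have /sub_kermxP := nz_row_sub (kermx A).
move=> /matrixP /(_ 0 (Ordinal js)); rewrite !mxE => E.
rewrite [X in r2v X]row_sum_delta linear_sum linear_sumlz -[RHS]E.
by apply: eq_bigr => i _; rewrite linearZ linearZl_LR !mxE.
Qed.

(* The contraction of w^[m+1] with v is w(v, .) /\ w^[m]; take v orthogonal to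
   vectors on which w^[m] does not vanish. *)
Lemma wedge_dpow_neq0 (w : {biscalar V}) m : symplectic w ->
  (2 * m <= dim V)%N ->
  exists2 s, size s = (2 * m)%N & wedge_dpow m w s != 0.
Proof.
move=> [_ nd]; elim: m => [|m IH] md; first by exists [::]; rewrite ?oner_eq0.
have [|s ss sn0] := IH; first by apply: leq_trans md; rewrite leq_mul2l leqnSn.
have [|v vn0 vs] := @exists_orthogonal w s.
  by rewrite ss; apply: leq_trans md; rewrite mulnS ltnS leqnSn.
have [u wvu] : exists u, w v u != 0.
  apply: contrapT => H; move/eqP: vn0; apply; apply: nd => u.
  by apply/eqP/negPn/negP => wvu; apply: H; exists u.
exists [:: v, u & s]; first by rewrite /= ss mulnS.
(* Since [v] is orthogonal to [s], only the product of [w v u] and the value at [s] survives. *)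
by rewrite /= wedge_form1_cons [X in _ - X]wedge1_eq0 // subr0 mulf_neq0.
Qed.

Definition gram (w : V -> V -> k) : 'M[k]_(dim V) :=
  \matrix_(i, j) w (r2v (delta_mx 0 i)) (r2v (delta_mx 0 j)).

Lemma gramE (w : {biscalar V}) u v : w u v = mxform (gram w) (v2r u) (v2r v).
Proof.
have E (x : V) : x = \sum_i v2r x 0 i *: r2v (delta_mx 0 i).
  rewrite -[LHS]v2rK [in LHS](row_sum_delta (v2r x)) linear_sum.
  by apply: eq_bigr => i _; rewrite linearZ.
rewrite mxform_sum [in LHS](E u) linear_sumlz; apply: eq_bigr => i _.
rewrite linearZl_LR [in LHS](E v) linear_sumr mulr_sumr; apply: eq_bigr => j _.
by rewrite linearZr_LR !mxE mulrA.
Qed.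

Lemma gram_skew (w : {biscalar V}) : (forall u, w u u = 0) ->
  (gram w)^T = - gram w.
Proof.
move=> w0; apply/matrixP=> i j; rewrite !mxE.
set u := r2v _; set v := r2v _; have := w0 (u + v).
rewrite linearDr /= !linearDl /= !w0 addr0 add0r => /eqP.
by rewrite addr_eq0 => /eqP ->; rewrite ?opprK.
Qed.

Lemma gplus_gram (w : {biscalar V}) (y : 'End(V)) : gplus w y ->
  f2mx y *m gram w = gram w *m (f2mx y)^T.
Proof.
move=> gy; have yE u : v2r (y u) = v2r u *m f2mx y by rewrite unlock /= r2vK.
apply/matrixP=> i j; have := gy (r2v (delta_mx 0 i)) (r2v (delta_mx 0 j)).
rewrite !gramE !yE !r2vK -!mxform_delta /mxform trmx_mul !mulmxA.
by [].
Qed.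

(** A zero value on the basis would kill the whole top form, against [wedge_dpow_neq0]. *)
Lemma pf_gram_neq0 (w : {biscalar V}) n : 2%:R != 0 :> k ->
  dim V = (2 * n)%N -> symplectic w -> pf n (gram w) != 0.
Proof.
move=> c2 dn sw; have [|s _ sn0] := @wedge_dpow_neq0 w n sw.
  by rewrite dn.
apply: contra sn0 => /eqP pf0; apply/eqP.
rewrite -[LHS]/(idfun _).
rewrite (@wedge_dpow_morph _ _ _ _ _ v2r _ _ (mxform (gram w))).
  apply: top_form_eq0 pf0 _; rewrite [X in ext_power X]dn.
  apply: (@ext_power_mxform _ _ _ _ (2%:R^-1)); last exact/gram_skew/(proj1 sw).
  by rewrite -[LHS]mulr_natr mulVf.
by move=> u v; exact: gramE.
Qed.

(** * Base change to [R], and the norm as a quotient of Pfaffians *)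

Variable R : comAlgType k.
Notation VR := (base_space V R).

Definition base_gram (w : V -> V -> k) : 'M[R]_(dim V) :=
  map_mx (in_alg R) (gram w).

Lemma base_form_gram w : base_form (R := R) w =2 mxform (base_gram w).
Proof.
move=> u v; rewrite mxform_sum; apply: eq_bigr => i _; apply: eq_bigr => j _.
by rewrite !mxE.
Qed.

(* Not f2mx x: the coordinates v2r of a row vector of VR are its mxvec. *)
Definition end_mx (x : 'End(VR)) : 'M[R]_(dim V) := lin1_mx x.

Lemma end_mxE (x : 'End(VR)) u : u *m end_mx x = x u.
Proof. exact: mul_rV_lin1. Qed.

Lemma eq_mulmx_rV (X Y : 'M[R]_(dim V)) :
  (forall u : 'rV_(dim V), u *m X = u *m Y) -> X = Y.
Proof. by move=> E; apply/row_matrixP => i; rewrite !rowE E. Qed.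

Lemma end_mx_comp (x y : 'End(VR)) : end_mx (x \o y)%VF = end_mx y *m end_mx x.
Proof.
by apply: eq_mulmx_rV => u; rewrite mulmxA !end_mxE comp_lfunE.
Qed.

Lemma gplus_pts_gram (w : {biscalar V}) (x : 'End(VR)) : gplus_pts w x ->
  end_mx x *m base_gram w = base_gram w *m (end_mx x)^T.
Proof.
move=> [m [r [y [gy ->]]]].
have -> : end_mx (\sum_i r i *: base_end R (y i)) =
    \sum_i r i *: map_mx (in_alg R) (f2mx (y i)).
  apply: eq_mulmx_rV => u; rewrite end_mxE sum_lfunE mulmx_sumr.
  by apply: eq_bigr => i _; rewrite scale_lfunE lfunE -scalemxAr.
rewrite mulmx_suml linear_sum mulmx_sumr; apply: eq_bigr => i _.
rewrite linearZ /= -scalemxAl -scalemxAr map_trmx -!map_mxM.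
by rewrite gplus_gram.
Qed.

(** Proportionality of top forms shows that the right-hand side solves the defining equation, and
    evaluation at the basis that it is the only solution; so [xget] never takes its default 0. *)
Lemma pfaffian_normE (w : {biscalar V}) n (half c : R) (x : 'End(VR)) :
  dim V = (2 * n)%N -> half *+ 2 = 1 -> (forall u, w u u = 0) ->
  c * pf n (base_gram w) = 1 ->
  end_mx x *m base_gram w = base_gram w *m (end_mx x)^T ->
  pfaffian_norm (wedge_dpow n) w x = c * pf n (end_mx x *m base_gram w).
Proof.
move=> dn h2 w0 cW ax; set W := base_gram w in cW ax *.
have sW : W^T = - W by rewrite /W /base_gram map_trmx gram_skew // map_mxN.
have sxW : (end_mx x *m W)^T = - (end_mx x *m W).
  by rewrite trmx_mul sW mulNmx ax.
have eW := eq_wedge_dpow n (base_form_gram w).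
have exW : wedge_dpow n (fun u v => base_form w (x u) v) =1
    wedge_dpow n (mxform (end_mx x *m W)).
  apply: eq_wedge_dpow => u v; rewrite base_form_gram -end_mxE.
  by rewrite /mxform !mulmxA.
have pW := ext_power_mxform n h2 sW; have pxW := ext_power_mxform n h2 sxW.
rewrite -[X in ext_power X]dn in pW pxW.
rewrite /pfaffian_norm; apply: xget_unique => [s|c' c'E].
  rewrite eW exW -mulrA [X in _ * X]mulrC.
  by rewrite -(top_form_prop s pxW pW) mulrCA [X in _ * X]cW mulr1.
have := c'E (std_basis R (dim V)); rewrite eW exW => e.
by rewrite /pf -e mulrCA [X in _ * X]cW mulr1.
Qed.

End SymplecticSpace.

(** The coordinate ring of the commuting scheme is one of the algebras [R], its universal point one
    of the pairs. The divided power provides a generator in every characteristic other than 2; the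
    power itself is treated wherever it generates. *)
Theorem proposition3p1 (k : fieldType) (char_k : 2%N \notin [pchar k])
    (n : nat) (V : vectType k) (dimV : \dim {: V} = (2 * n)%N)
    (w0 : {biscalar V}) (w0_symplectic : symplectic w0)
    (R : comAlgType k) :
  (generates (2 * n) (wedge_dpow n (base_form (R := R) w0)) /\
   forall x y : 'End(base_space V R), commuting_pts w0 x y ->
     pfaffian_norm (wedge_dpow n) w0 (x \o y)%VF =
     pfaffian_norm (wedge_dpow n) w0 x * pfaffian_norm (wedge_dpow n) w0 y)
  /\
  (generates (2 * n) (wedge_pow n (base_form (R := R) w0)) ->
   forall x y : 'End(base_space V R), commuting_pts w0 x y ->
     pfaffian_norm (wedge_pow n) w0 (x \o y)%VF =
     pfaffian_norm (wedge_pow n) w0 x * pfaffian_norm (wedge_pow n) w0 y).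
Proof.
have dn : dim V = (2 * n)%N by rewrite -dimV dimvf.
have two0 : 2%:R != 0 :> k by move: char_k; rewrite inE.
pose half : R := in_alg R 2%:R^-1.
have h2 : half *+ 2 = 1.
  by rewrite -rmorphMn -[_ *+ 2]mulr_natr mulVf // rmorph1.
pose W := base_gram R w0; pose c : R := in_alg R (pf n (gram w0))^-1.
have cW : c * pf n W = 1.
  by rewrite /W /base_gram pf_morph -rmorphM mulVf ?rmorph1 ?pf_gram_neq0.
have w0alt := proj1 w0_symplectic.
have sW : W^T = - W by rewrite /W /base_gram map_trmx gram_skew // map_mxN.
have pW : ext_power (2 * n) (wedge_dpow n (base_form (R := R) w0)).
  apply: ext_power_eq (ext_power_mxform n h2 sW).
  exact: eq_wedge_dpow (base_form_gram w0).
have Fe : wedge_dpow n (base_form (R := R) w0) (std_basis R (dim V)) = pf n W.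
  exact: eq_wedge_dpow (base_form_gram w0) _.
have normM (x y : 'End(base_space V R)) : commuting_pts w0 x y ->
    pfaffian_norm (wedge_dpow n) w0 (x \o y)%VF =
    pfaffian_norm (wedge_dpow n) w0 x * pfaffian_norm (wedge_dpow n) w0 y.
  move=> [/gplus_pts_gram ax /gplus_pts_gram ay cxy].
  have cXY : end_mx x *m end_mx y = end_mx y *m end_mx x.
    by rewrite -!end_mx_comp cxy.
  (* Commutation makes the product self-adjoint, so that [pfaffian_normE] covers it too. *)
  have axy : end_mx (x \o y)%VF *m W = W *m (end_mx (x \o y)%VF)^T.
    by rewrite end_mx_comp trmx_mul mulmxA -ax -!mulmxA -ay !mulmxA cXY.
  rewrite !(pfaffian_normE dn h2 w0alt cW) // -/W end_mx_comp -cXY.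
  have e := pf_mul dn h2 sW ax ay cXY.
  by rewrite mulrACA -e mulrACA [X in _ = _ * X]cW mulr1.
split; last first.
  move=> [_ /(_ _ pW)[a [aE _]]].
  (* If the power generates, the divided power is [a] times it, hence [a * n!] times itself; its
     value on the basis is a unit, so [n!] is invertible. *)
  have aU : a * n`!%:R = 1.
    have := aE (std_basis R (dim V)); rewrite wedge_pow_dpow Fe => e.
    by rewrite -[LHS]mulr1 -[X in _ * X]cW mulrCA -[X in c * X]mulrA -e cW.
  (* The equations defining the two norms differ by the unit [n!]. *)
  have E (x : 'End(base_space V R)) :
      pfaffian_norm (wedge_pow n) w0 x = pfaffian_norm (wedge_dpow n) w0 x.
    congr xget; apply/seteqP; split=> b /= H s; last first.
      by rewrite !wedge_pow_dpow mulrCA H.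
    have := H s; rewrite !wedge_pow_dpow => e.
    rewrite -[RHS]mul1r -[X in _ = X * _]aU -mulrA -e [RHS]mulrCA.
    by rewrite [X in _ = _ * X]mulrA [X in _ = _ * (X * _)]aU mul1r.
  by move=> x y; rewrite !E; exact: normM.
split=> //; split=> // G pG.
(* The coefficient is the ratio of the values at the standard basis, [c] being the inverse of
   [pf n W]. *)
exists (c * G (std_basis R (dim V))); split=> [s|b bE].
  have pW' := pW; rewrite -[X in ext_power X]dn in pW' pG.
  have := top_form_prop s pG pW'; rewrite Fe => e.
  by rewrite -mulrA [X in _ * X]mulrC -e mulrCA cW mulr1.
by rewrite bE Fe mulrCA cW mulr1.
Qed.
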